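(* For any $p\in\mathbb N$ (with $p\ge 1$), Repeated Dual-OHM with period $p$ exhibits the following rate: for every nonexpansive $T:\mathcal X\to\mathcal X$ with a fixed point $y_\star$ and every $y_0\in\mathcal X$, $$\|y_{kp}-Ty_{kp}\|^2\le\frac{4\|y_0-y_\star\|^2}{(kp+1)^2}\qquad\text{for } k=1,2,\dots.$$
   Context: $\mathcal X$ is a real Hilbert space; $T:\mathcal X\to\mathcal X$ is nonexpansive if $\|Tx-Ty\|\le\|x-y\|$ for all $x,y\in\mathcal X$; a fixed point is $y_\star$ with $Ty_\star=y_\star$. A lower triangular real matrix $H=(h_{k,j})_{1\le j\le k\le M}$ defines the $M$-step algorithm $y_{k+1}=y_k-\sum_{j=0}^{k}h_{k+1,j+1}(y_j-Ty_j)$, $k=0,\dots,M-1$; $[\,]$ denotes the $0\times0$ matrix. For $H$ of size $N-1$ and $m,j\in\{1,\dots,N-1\}$, $Q(m,j;H)=\sum\prod_{r=1}^m h_{i(r),j(r)}$, the sum over all integers $j=j(1)\le i(1)<j(2)\le i(2)<\cdots<j(m)\le i(m)\le N-1$. Gluing. For $1\le N'\le N-1$ and $H_1,H_2$ of sizes $N'-1$ and $N-N'-1$, $H_1\bowtie H_2$ is the lower triangular $(N-1)\times(N-1)$ matrix with entries: $h_{k,j}=(H_1)_{k,j}$ for $1\le j\le k\le N'-1$; $h_{k,j}=(H_2)_{k-N',j-N'}$ for $N'+1\le j\le k\le N-1$; $h_{k,j}=0$ for $j\le N'-1$, $k\ge N'+1$; $h_{N',j}=-\frac{N-N'}{N}\sum_{k=j}^{N'-1}(H_1)_{k,j}$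 for $j\le N'-1$; $h_{N',N'}=\frac{N'(N-N')}{N}$; and $h_{N'+1,N'},\dots,h_{N-1,N'}$ are the unique values with $Q(m,N';H_1\bowtie H_2)=\frac{N'(N-N'+1)}{N(m+1)}\binom{N-N'-1}{m-1}$ for $m=1,\dots,N-N'$. Dual-OHM. $H_{\text{Dual-OHM}}(0)=[\,]$, and $H_{\text{Dual-OHM}}(N-1)$ is the $(N-1)\times(N-1)$ lower triangular matrix with entries $-\frac{N-k}{(N-j)(N-j+1)}$ for $j<k$ and $\frac{N-k}{N-k+1}$ for $j=k$. Repeated Dual-OHM (RDO) with period $p$. Let $H^{(0)}_{\mathrm{RDO}(p)}=[\,]$ and $H^{(n)}_{\mathrm{RDO}(p)}=H^{(n-1)}_{\mathrm{RDO}(p)}\bowtie H_{\text{Dual-OHM}}(p-1)\in\mathbb R^{np\times np}$ for $n\ge1$. RDO with period $p$ is the algorithm whose H-matrix for the first $np$ iterations is $H^{(n)}_{\mathrm{RDO}(p)}$ for all $n\ge1$ (well defined, since each $H^{(n)}_{\mathrm{RDO}(p)}$ is the upper left submatrix of the later ones). *)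

(* Defs.v *)
From HB Require Import structures.
From mathcomp Require Import all_boot all_order all_algebra.
From mathcomp Require Import sesquilinear.
From mathcomp Require Import all_classical all_reals all_analysis.
Import Order.TTheory GRing.Theory Num.Theory.
Import numFieldNormedType.Exports.

Set Implicit Arguments.
Unset Strict Implicit.
Unset Printing Implicit Defensive.

Local Open Scope classical_set_scope.
Local Open Scope ring_scope.

(* A real Hilbert space is a complete normed space whose norm comes from a
   positive definite symmetric bilinear form. *)
Definition norm_from_dot (R : realType) (X : completeNormedModType R)
  (dot : {dot X for idfun}) : Prop := forall x : X, dot x x = `|x| ^+ 2.

Definition nonexpansive (R : realType) (X : completeNormedModType R)
  (T : X -> X) : Prop := forall x y : X, `|T x - T y| <= `|x - y|.

(* The formulas below number rows and columns from 1, as in h_{k,j}; [entry]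
   translates to the 0-based indices of matrices.  It is only meaningful for
   1 <= k <= m and 1 <= j <= n. *)
Definition entry (R : realType) (m n : nat) (A : 'M[R]_(m, n)) (k j : nat) : R :=
  match insub k.-1, insub j.-1 with
  | Some i, Some l => A i l
  | _, _ => 0
  end.

(* [y 0], ..., [y M] are the iterates of the M-step algorithm given by H. *)
Definition is_run (R : realType) (X : completeNormedModType R) (M : nat)
  (H : 'M[R]_M) (T : X -> X) (y : nat -> X) : Prop :=
  forall k, (k < M)%N ->
    y k.+1 = y k - \sum_(0 <= j < k.+1) entry H k.+1 j.+1 *: (y j - T (y j)).

(* Q(m, j; H): the chains j = j(1) <= i(1) < j(2) <= ... <= i(m) are given by
   the 0-based index functions [i] and [l], so that i(r) = (i r).+1 and
   j(r) = (l r).+1. *)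
Definition Q (R : realType) (n : nat) (H : 'M[R]_n) (m j : nat) : R :=
  \sum_(i : {ffun 'I_m -> 'I_n})
    \sum_(l : {ffun 'I_m -> 'I_n} |
        [&& [forall r : 'I_m, (r == 0%N :> nat) ==> ((l r).+1 == j)],
            [forall r : 'I_m, (l r <= i r)%N] &
            [forall r : 'I_m, forall s : 'I_m,
               (s == r.+1 :> nat) ==> (i r < l s)%N]])
      \prod_(r < m) H (i r) (l r).

(* Here N' = N1, N - N' = N2 and N = N1 + N2, with N1, N2 >= 1; [c] holds the
   entries h_{N'+1,N'}, ..., h_{N-1,N'}. *)
Definition glue_with (R : realType) (N1 N2 : nat)
  (H1 : 'M[R]_(N1.-1)) (H2 : 'M[R]_(N2.-1)) (c : 'cV[R]_(N2.-1)) :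
  'M[R]_((N1 + N2).-1) :=
  \matrix_(k0, j0)
    let k := k0.+1 in let j := j0.+1 in
    if (k < j)%N then 0
    else if (k < N1)%N then entry H1 k j
    else if (N1 < j)%N then entry H2 (k - N1) (j - N1)
    else if k == N1 then
      if j == N1 then (N1 * N2)%:R / (N1 + N2)%:R
      else - (N2%:R / (N1 + N2)%:R) * \sum_(j <= i < N1) entry H1 i j
    else if j == N1 then entry c (k - N1) 1
    else 0.

Definition glue_eqs (R : realType) (N1 N2 : nat)
  (H1 : 'M[R]_(N1.-1)) (H2 : 'M[R]_(N2.-1)) (c : 'cV[R]_(N2.-1)) : Prop :=
  forall m, (1 <= m <= N2)%N ->
    Q (glue_with H1 H2 c) m N1 =
      (N1 * N2.+1)%:R / ((N1 + N2) * m.+1)%:R * 'C(N2.-1, m.-1)%:R.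

(* When the diagonal of H2 has no zero, the equations are triangular in c, with
   nonzero pivots, so they have at most one solution; [xget] selects it if it
   exists. *)
Definition glue (R : realType) (N1 N2 : nat)
  (H1 : 'M[R]_(N1.-1)) (H2 : 'M[R]_(N2.-1)) : 'M[R]_((N1 + N2).-1) :=
  glue_with H1 H2 (xget 0 [set c | glue_eqs H1 H2 c]).

(* H_{Dual-OHM}(N - 1) *)
Definition H_DualOHM (R : realType) (N : nat) : 'M[R]_(N.-1) :=
  \matrix_(k0, j0)
    let k := k0.+1 in let j := j0.+1 in
    if (j < k)%N then - ((N - k)%:R / ((N - j) * (N - j).+1)%:R)
    else if j == k then (N - k)%:R / (N - k).+1%:R
    else 0.

(* N' = np + 1 and N = (n + 1)p + 1; the cast is along np + p = (n + 1)p. *)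
Fixpoint H_RDO (R : realType) (p n : nat) : 'M[R]_(n * p) :=
  match n with
  | 0 => 0
  | n'.+1 => castmx (esym (mulSnr n' p), esym (mulSnr n' p))
               (@glue R (n' * p).+1 p (H_RDO R p n') (H_DualOHM R p))
  end.

Definition is_RDO_run (R : realType) (X : completeNormedModType R) (p : nat)
  (T : X -> X) (y : nat -> X) : Prop :=
  forall n, (1 <= n)%N -> is_run (H_RDO R p n) T y.

Lemma entryE (R : realType) (m n : nat) (A : 'M[R]_(m, n)) (i : 'I_m) (l : 'I_n) :
  entry A i.+1 l.+1 = A i l.
Proof. by rewrite /entry /= !valK. Qed.

(* Each matrix of the RDO family is the upper left block of the next one. *)
Lemma H_RDO_nested (R : realType) (p n k j : nat) :
  (1 <= j <= k)%N -> (k <= n * p)%N ->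
  entry (H_RDO R p n.+1) k j = entry (H_RDO R p n) k j.
Proof.
case/andP; case: j => // j _; case: k => // k le_jk lt_kn.
have lt_k : (k < n.+1 * p)%N.
  by apply: leq_trans lt_kn _; rewrite leq_mul2r leqnSn orbT.
have lt_j : (j < n.+1 * p)%N by apply: leq_ltn_trans lt_k.
rewrite -[k in LHS]/(val (Ordinal lt_k)) -[j in LHS]/(val (Ordinal lt_j)) entryE.
rewrite castmxE /= mxE /=.
by rewrite ltnS ltnNge (ltnS j k) in le_jk *; rewrite le_jk /= ltnS lt_kn.
Qed.

(* Hence the RDO iterates exist for every starting point. *)
Lemma RDO_run_exists (R : realType) (X : completeNormedModType R) (p : nat)
  (hp : (1 <= p)%N) (T : X -> X) (y0 : X) :
  exists2 y : nat -> X, y 0%N = y0 & is_RDO_run p T y.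
Proof.
pose h k j := entry (H_RDO R p k) k j.
pose next (y : nat -> X) k :=
  y k - \sum_(0 <= j < k.+1) h k.+1 j.+1 *: (y j - T (y j)).
pose F := fix F k : nat -> X := if k is k'.+1 then
  fun i => if (i <= k')%N then F k' i else next (F k') k' else fun=> y0.
have FE k i : (i <= k)%N -> F k i = F i i.
  elim: k => [|k IH]; first by rewrite leqn0 => /eqP ->.
  by rewrite leq_eqVlt ltnS => /predU1P[-> //|le_ik] /=; rewrite le_ik IH.
exists (fun k => F k k) => // n n1 k lt_k.
rewrite /= ltnn /next; congr (_ - _); apply: eq_big_nat => j /andP[_ lt_j].
rewrite FE //; congr (_ *: _); rewrite /h.
have nested a d : (k.+1 <= a * p)%N ->
    entry (H_RDO R p (a + d)) k.+1 j.+1 = entry (H_RDO R p a) k.+1 j.+1.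
  move=> le_a; elim: d => [|d IH]; first by rewrite addn0.
  rewrite addnS H_RDO_nested ?IH //.
  by apply: leq_trans le_a _; rewrite leq_mul2r leq_addr orbT.
have le_k : (k.+1 <= k.+1 * p)%N by rewrite leq_pmulr.
have [/subnKC eq_n|/ltnW/subnKC eq_k] := leqP k.+1 n.
  by rewrite -[in RHS]eq_n nested.
by rewrite -(nested n (k.+1 - n)%N) // eq_k.
Qed.

(* Main.v *)
(** Write [g = (y - T y) / 2] for the residual, which is 1-cocoercive, and
    [M = np], [N = M + 1 + p], [K = (M + 1) / N].  The defining equations of the
    glued column are solved by [c_k = - K (p - k) / p], because the chains
    of length [m] inside the last [r - 1] rows of Dual-OHM sum to
    [binomial(r, m + 1) / r].  The next [p] steps then
    amount to a restart [w_1] of [w_0 = y_M] followed by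
    [w_(k+1) = w_k - 2 r (x_(k+1) - x_k)] with [r = p - k], [x_1 = K g_0] and
    [(r + 1) x_(k+1) = r x_k + g_k].  One shows by induction on [n] that
    [np |g|^2 <= <g, y_0 - y_np>] for the residual [g] at [y_np]: the
    step uses only the cocoercivity inequalities between [w_p] and the earlier
    [w_k], whose weighted sum telescopes.  Adding the cocoercivity inequality
    between [y_np] and [ystar] gives [(np + 1) |g|^2 <= <g, y_0 - ystar>], and
    expanding [0 <= |y_0 - ystar - (np + 1) g|^2] concludes. *)

Require Import Defs.
From HB Require Import structures.
From mathcomp Require Import all_boot all_order all_algebra.
From mathcomp Require Import sesquilinear.
From mathcomp Require Import all_classical all_reals all_analysis.
From mathcomp Require Import ring lra zify.
Import Order.TTheory GRing.Theory Num.Theory.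
Import numFieldNormedType.Exports.
Local Open Scope ring_scope.

(** * Inner product inequalities: the energy argument over one period *)

Section InnerProduct.

Context {R : realFieldType} {X : lmodType R} (dot : {dot X for idfun}).

Lemma dotC (u v : X) : dot u v = dot v u.
Proof. by rewrite hermC expr0 mul1r. Qed.

Lemma dotZl (a : R) (u v : X) : dot (a *: u) v = a * dot u v.
Proof. exact: linearZl_LR. Qed.

Lemma dotZr (a : R) (u v : X) : dot u (a *: v) = a * dot u v.
Proof. by rewrite dotC dotZl dotC. Qed.

Lemma dotDl (u v w : X) : dot (u + v) w = dot u w + dot v w.
Proof. exact: linearDl. Qed.

Lemma dotDr (u v w : X) : dot w (u + v) = dot w u + dot w v.
Proof. exact: linearDr. Qed.

Lemma dotNl (u v : X) : dot (- u) v = - dot u v.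
Proof. exact: linearNl. Qed.

Lemma dotNr (u v : X) : dot u (- v) = - dot u v.
Proof. exact: linearNr. Qed.

Definition dotE := (dotDl, dotDr, dotNl, dotNr, dotZl, dotZr).

Lemma dot_ge0 (u : X) : 0 <= dot u u.
Proof.
by have [->|/neq0_dnorm_gt0/ltW//] := eqVneq u 0; rewrite linear0l.
Qed.

(** The right side is the increase of the potential (<z, s> + r |z|^2) / (r + 1) when r drops to r -
    1. Once [d] and [s'] are substituted, both sides are the same combination of the inner products
    among [z], [z'] and [s]. *)
Lemma potential_step (r : R) (z z' s s' d : X) : 0 < r ->
  d = (r + 1) *: z' - r *: z -> s' = s - (2 * r) *: (z' - z) ->
  (dot d s - dot d d) / (r * (r + 1)) =
  (dot z' s' + (r - 1) * dot z' z') / r - (dot z s + r * dot z z) / (r + 1).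
Proof.
move=> r0 -> ->; rewrite !dotE (dotC z z').
by field; rewrite !lt0r_neq0 // ltr_wpDl // ltW.
Qed.

(* With r = p - k, z = g_p - x_k and s = w_p - w_k, the cocoercivity inequalities
   weighted by 1 / (r (r + 1)) telescope along (<z, s> + r |z|^2) / (r + 1). *)
Lemma dual_ohm_bound (p : nat) (w g x : nat -> X) : (1 <= p)%N ->
  (forall k, (1 <= k < p)%N ->
     (p - k).+1%:R *: x k.+1 = (p - k)%:R *: x k + g k) ->
  (forall k, (1 <= k < p)%N ->
     w k.+1 = w k - (2 * (p - k)%:R) *: (x k.+1 - x k)) ->
  (forall k, (1 <= k < p)%N ->
     dot (g p - g k) (g p - g k) <= dot (g p - g k) (w p - w k)) ->
  dot (g p - x 1%N) (w p - w 1%N) + p.-1%:R * dot (g p - x 1%N) (g p - x 1%N)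
    <= 0.
Proof.
move=> p1 hx hw hg.
pose pot k := (dot (g p - x k) (w p - w k)
  + (p - k)%:R * dot (g p - x k) (g p - x k)) / (p - k).+1%:R.
have step k : (1 <= k < p)%N -> pot k <= pot k.+1.
  move=> hk; have /andP[k1 kp] := hk; rewrite /pot.
  rewrite (subnSK kp).
  have r0 : 0 < (p - k)%:R :> R by rewrite ltr0n subn_gt0.
  have -> : (p - k.+1)%:R = (p - k)%:R - 1 :> R.
    by rewrite -(subnSK kp) -[in RHS]natr1 addrK.
  rewrite -natr1 -subr_ge0.
  rewrite -(@potential_step _ _ _ _ _ (g p - g k)) //.
  - apply: divr_ge0; first by rewrite subr_ge0 hg.
    by rewrite mulr_ge0 ?addr_ge0 // ltW.
  - have /(congr1 (fun u => u - (p - k)%:R *: x k)) := hx k hk.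
    rewrite addrAC subrr add0r => <-; rewrite -natr1.
    rewrite !scalerBr [in RHS]opprD opprK [in RHS]addrACA -scalerBl.
    by rewrite (addrC _ 1) addrK scale1r opprB (addrC (- _)).
  - have -> : g p - x k.+1 - (g p - x k) = - (x k.+1 - x k).
      by rewrite !opprB addrC subrKA.
    by rewrite hw // scalerN opprK opprB addrA addrAC.
have mono k : (1 <= k <= p)%N -> pot 1%N <= pot k.
  elim: k => // -[|k] IH // /andP[_ kp].
  by apply: (le_trans (IH _)) (step _ _); rewrite //= ltnW.
(* At k = p the potential vanishes, since both w_p - w_p and the weight p - p do; at k = 1 it is the
   left side of the goal divided by p. *)
have := mono p; rewrite p1 leqnn /pot => /(_ isT).
rewrite subrr linear0r subnn mul0r addr0 mul0r.
by rewrite subn1 prednK // pmulr_lle0 // invr_gt0 ltr0n.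
Qed.

(* Up to the factors N / p, (n + 1) / p and (n + 1) / N, where N = n + 1 + p, the
   conclusion is the sum of [dual_ohm_bound], the cocoercivity inequality between
   w_0 and w_p, and the bound already known at w_0. *)
Lemma glued_bound (n p : nat) (y0 : X) (w g x : nat -> X) : (1 <= p)%N ->
  w 1%N - w 0%N = (p%:R / (n.+1 + p)%:R) *: (y0 - w 0%N)
    - (2 * (n.+1 * p)%:R / (n.+1 + p)%:R) *: g 0%N ->
  x 1%N = (n.+1%:R / (n.+1 + p)%:R) *: g 0%N ->
  (forall k, (1 <= k < p)%N ->
     (p - k).+1%:R *: x k.+1 = (p - k)%:R *: x k + g k) ->
  (forall k, (1 <= k < p)%N ->
     w k.+1 = w k - (2 * (p - k)%:R) *: (x k.+1 - x k)) ->
  (forall k, (k < p)%N ->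
     dot (g p - g k) (g p - g k) <= dot (g p - g k) (w p - w k)) ->
  n%:R * dot (g 0%N) (g 0%N) <= dot (g 0%N) (y0 - w 0%N) ->
  (n + p)%:R * dot (g p) (g p) <= dot (g p) (y0 - w p).
Proof.
move=> p1 hw1 hx1 hx hw hg h0.
have A : dot (g p - x 1%N) (w p - w 1%N)
    + p.-1%:R * dot (g p - x 1%N) (g p - x 1%N) <= 0.
  by apply: dual_ohm_bound => // k /andP[_ kp]; apply: hg.
have B := hg 0%N p1.
set P : R := p%:R; set M : R := n%:R.
have P0 : 0 < P by rewrite ltr0n.
have M0 : 0 <= M by rewrite ler0n.
have eN : (n.+1 + p)%:R = M + 1 + P by rewrite natrD -natr1.
have eP : p.-1%:R = P - 1 by rewrite -subn1 natrB.
have e1 : (n.+1)%:R = M + 1 by rewrite -natr1.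
rewrite eN e1 natrM e1 -/P in hw1 hx1; rewrite eP in A; rewrite natrD -/P -/M.
have N0 : 0 < M + 1 + P by lra.
set v := y0 - w 0%N in hw1 h0 *.
have -> : y0 - w p = v - (w 1%N - w 0%N) - (w p - w 1%N).
  by rewrite -addrA -opprD [X in _ = _ - X]addrC subrKA opprB subrKA.
have eB : w p - w 0%N = (w p - w 1%N) + (w 1%N - w 0%N) by rewrite subrKA.
rewrite eB {eB} in B; rewrite hx1 in A; rewrite hw1 in B *.
have cA : 0 <= (M + 1 + P) / P by apply: divr_ge0; lra.
have cB : 0 <= (M + 1) / P by apply: divr_ge0; lra.
have cC : 0 <= (M + 1) / (M + 1 + P) by apply: divr_ge0; lra.
move: A; rewrite -oppr_ge0 => /(mulr_ge0 cA) A.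
move: B; rewrite -subr_ge0 => /(mulr_ge0 cB) B.
move: h0; rewrite -subr_ge0 => /(mulr_ge0 cC) C.
rewrite -subr_ge0; apply: le_trans (addr_ge0 (addr_ge0 A B) C) _.
rewrite le_eqVlt; apply/orP; left; apply/eqP.
rewrite !dotE (dotC (g 0%N) (g p)) -/M.
by field; rewrite !lt0r_neq0 //.
Qed.

End InnerProduct.

(** * Sums over chains and the recursion on their first link *)

Section ChainSums.

Context {R : realType} {n : nat} (H : 'M[R]_n).

(** Kept in the exact shape of the side condition of [Q], so that [Q] is a chain sum by
    conversion. *)
Definition is_chain {m : nat} (P : pred nat) (i l : {ffun 'I_m -> 'I_n}) :=
  [&& [forall r : 'I_m, (r == 0%N :> nat) ==> P (l r)],
      [forall r : 'I_m, (l r <= i r)%N] &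
      [forall r : 'I_m, forall s : 'I_m,
         (s == r.+1 :> nat) ==> (i r < l s)%N]].

(* [Q] with the first index ranging over a predicate: this class of sums is closed
   under removing the first link of the chains. *)
Definition chain_sum (m : nat) (P : pred nat) : R :=
  \sum_(i : {ffun 'I_m -> 'I_n}) \sum_(l : {ffun 'I_m -> 'I_n} | is_chain P i l)
    \prod_(r < m) H (i r) (l r).

Lemma Q_chain_sum (m j : nat) : Q H m j = chain_sum m (fun x => x.+1 == j).
Proof. by []. Qed.

Definition ffun_cons {T : Type} {m : nat} (a : T) (f : {ffun 'I_m -> T}) :
    {ffun 'I_m.+1 -> T} :=
  [ffun r => if unlift ord0 r is Some s then f s else a].

Lemma ffun_cons0 (T : Type) (m : nat) (a : T) (f : {ffun 'I_m -> T}) :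
  ffun_cons a f ord0 = a.
Proof. by rewrite ffunE unlift_none. Qed.

Lemma ffun_consS (T : Type) (m : nat) (a : T) (f : {ffun 'I_m -> T}) s :
  ffun_cons a f (lift ord0 s) = f s.
Proof. by rewrite ffunE liftK. Qed.

Lemma sum_ffun_cons (T : finType) (m : nat) (F : {ffun 'I_m.+1 -> T} -> R) :
  \sum_f F f = \sum_a \sum_f F (ffun_cons a f).
Proof.
rewrite pair_big (reindex (fun u : T * {ffun 'I_m -> T} => ffun_cons u.1 u.2)) //.
exists (fun f : {ffun 'I_m.+1 -> T} => (f ord0, [ffun s : 'I_m => f (lift ord0 s)]))
  => [[a f] _|f _] /=.
  rewrite ffun_cons0; congr (_, _); apply/ffunP => s.
  by rewrite ffunE ffun_consS.
apply/ffunP => r; have [s ->|->] := unliftP ord0 r.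
  by rewrite ffun_consS ffunE.
by rewrite ffun_cons0.
Qed.

(** The strict inequality between the first two links turns into the start predicate of the tail; it
    is vacuous for an empty tail. *)
Lemma is_chain_cons (m : nat) (P : pred nat) (a b : 'I_n)
    (i l : {ffun 'I_m -> 'I_n}) :
  is_chain P (ffun_cons a i) (ffun_cons b l) =
  [&& P b, (b <= a)%N & is_chain (fun x => (a < x)%N) i l].
Proof.
apply/and3P/and3P => [[/forallP h1 /forallP h2 h3]|
                      [hb hba /and3P[/forallP h1 /forallP h2 h3]]].
  have {}h3 (r s : 'I_m.+1) : s = r.+1 :> nat -> (ffun_cons a i r < ffun_cons b l s)%N.
    by move=> e; have /forallP/(_ r)/forallP/(_ s)/implyP := h3; apply; apply/eqP.
  split; first by have /= := h1 ord0; rewrite ffun_cons0.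
    by have := h2 ord0; rewrite !ffun_cons0.
  apply/and3P; split.
  - apply/forallP => r; apply/implyP => /eqP r0.
    by have := h3 ord0 (lift ord0 r); rewrite ffun_cons0 ffun_consS; apply; rewrite /= r0.
  - by apply/forallP => r; have := h2 (lift ord0 r); rewrite !ffun_consS.
  - apply/forallP => r; apply/forallP => s; apply/implyP => /eqP rs.
    have := h3 (lift ord0 r) (lift ord0 s); rewrite !ffun_consS; apply.
    by rewrite /= !/bump /= !add1n rs.
have {}h3 (r s : 'I_m) : s = r.+1 :> nat -> (i r < l s)%N.
  by move=> e; have /forallP/(_ r)/forallP/(_ s)/implyP := h3; apply; apply/eqP.
split.
- apply/forallP => r; have [s ->|->] := unliftP ord0 r; first by apply/implyP.
  by rewrite ffun_cons0; apply/implyP.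
- apply/forallP => r; have [s ->|->] := unliftP ord0 r.
    by rewrite !ffun_consS.
  by rewrite !ffun_cons0.
- apply/forallP => r; apply/forallP => s; apply/implyP => /eqP.
  have [s' ->|-> //] := unliftP ord0 s; rewrite ffun_consS.
  have [r' ->|->] := unliftP ord0 r; rewrite ?ffun_consS ?ffun_cons0 /=.
    by rewrite /bump /= !add1n => -[] /h3.
  by rewrite /bump /= add1n => -[] /eqP s0; have /implyP := h1 s'; apply.
Qed.

Lemma chain_sum0 (P : pred nat) : chain_sum 0 P = 1.
Proof.
rewrite /chain_sum (big_pred1 [ffun r : 'I_0 => False_rect _ (notF (ltn_ord r))]).
  rewrite (big_pred1 [ffun r : 'I_0 => False_rect _ (notF (ltn_ord r))]).
    by rewrite big_ord0.
  move=> l /=; rewrite (_ : l == _); last by apply/eqP/ffunP => -[].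
  by apply/and3P; split; apply/forallP => -[].
by move=> l /=; rewrite (_ : l == _) //; apply/eqP/ffunP => -[].
Qed.

Lemma chain_sumS (m : nat) (P : pred nat) :
  chain_sum m.+1 P = \sum_(b < n | P b) \sum_(a < n | (b <= a)%N)
    H a b * chain_sum m (fun x => (a < x)%N).
Proof.
rewrite /chain_sum sum_ffun_cons.
(* The chain condition is moved into a conditional, so that the sums can be interchanged freely. *)
transitivity (\sum_(a < n) \sum_(b < n)
    \sum_(i : {ffun 'I_m -> 'I_n}) \sum_(l : {ffun 'I_m -> 'I_n})
    if is_chain P (ffun_cons a i) (ffun_cons b l)
    then \prod_(r < m.+1) H (ffun_cons a i r) (ffun_cons b l r) else 0).
  apply: eq_bigr => a _; rewrite [RHS]exchange_big; apply: eq_bigr => i _.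
  by rewrite big_mkcond sum_ffun_cons.
rewrite [RHS]big_mkcond.
rewrite exchange_big /=; apply: eq_bigr => b _.
have [Pb|nPb] := boolP (P b); last first.
  rewrite big1 // => a _; rewrite big1 // => i _; rewrite big1 // => l _.
  by rewrite is_chain_cons (negPf nPb).
rewrite [RHS]big_mkcond /=; apply: eq_bigr => a _.
have [ba|nba] := leqP b a; last first.
  rewrite big1 // => i _; rewrite big1 // => l _.
  by rewrite is_chain_cons leqNgt nba andbF.
rewrite mulr_sumr; apply: eq_bigr => i _.
rewrite mulr_sumr big_mkcond [RHS]big_mkcond; apply: eq_bigr => l _.
rewrite is_chain_cons Pb ba /=; case: ifP => // _.
rewrite big_ord_recl !ffun_cons0; congr (_ * _).
by apply: eq_bigr => r _; rewrite !ffun_consS.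
Qed.

End ChainSums.

(** * Chains in the Dual-OHM block and the explicit glued column *)

Lemma entry_lt {R : realType} {m n : nat} (A : 'M[R]_(m, n)) {k j : nat}
    (km : (k < m)%N) (jn : (j < n)%N) :
  entry A k.+1 j.+1 = A (Ordinal km) (Ordinal jn).
Proof. by rewrite -entryE. Qed.

Lemma entry_DualOHM (R : realType) (p k j : nat) : (1 <= j <= k)%N -> (k < p)%N ->
  entry (H_DualOHM R p) k j =
  if j == k then (p - k)%:R / (p - k).+1%:R
  else - ((p - k)%:R / ((p - j) * (p - j).+1)%:R).
Proof.
case: j => // j; case: k => // k /= jk kp.
have kp' : (k < p.-1)%N by lia.
have jp' : (j < p.-1)%N by lia.
rewrite (entry_lt _ kp' jp') mxE /=.
by rewrite ltn_neqAle jk andbT; case: eqP.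
Qed.

Lemma sum_ord_geq {R : realType} (b M : nat) (F : nat -> R) :
  \sum_(i < M | (b <= i)%N) F i = \sum_(b <= i < M) F i.
Proof. by rewrite big_geq_mkord. Qed.

(** By Pascal's rule each term is a difference of consecutive values of - binomial(p - k + 1, m +
    2). *)
Lemma sum_bin_hockey (R : realType) (p l m : nat) : (l < p)%N ->
  \sum_(l.+1 <= k < p) 'C(p - k, m.+1)%:R = 'C(p - l, m.+2)%:R :> R.
Proof.
move=> lp; pose f k := - 'C((p - k).+1, m.+2)%:R : R.
transitivity (\sum_(l.+1 <= k < p) (f k.+1 - f k)).
  apply: eq_big_nat => k /andP[_ kp].
  by rewrite /f opprK addrC subnSK // binS natrD addrAC subrr add0r.
by rewrite telescope_sumr // /f subnn bin_small // oppr0 add0r opprK subnSK.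
Qed.

Section DualOHMColumn.

Context {R : realType} (n p : nat) (H1 : 'M[R]_(n.+1.-1)) (c : 'cV[R]_(p.-1)).

(** Here [n] is N' - 1, so the glued row and column have 0-based index [n]; the column [c] stays
    arbitrary until its equations are solved. *)
Let H : 'M[R]_(n + p) := glue_with H1 (H_DualOHM R p) c.

Lemma glue_DualOHM_block (a l : 'I_(n + p)) : (n < l <= a)%N ->
  H a l = entry (H_DualOHM R p) (a - n) (l - n).
Proof.
case/andP=> nl la; rewrite mxE /=.
rewrite (_ : (a.+1 < l.+1)%N = false); last by lia.
rewrite (_ : (a.+1 < n.+1)%N = false); last by lia.
by rewrite (_ : (n.+1 < l.+1)%N = true) ?subSS; last by lia.
Qed.

Lemma glue_DualOHM_col (a l : 'I_(n + p)) : l = n :> nat -> (n <= a)%N ->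
  H a l = if a == n :> nat then (n.+1 * p)%:R / (n.+1 + p)%:R
          else entry c (a - n) 1.
Proof.
move=> ln na; rewrite mxE /= ln.
rewrite (_ : (a.+1 < n.+1)%N = false); last by lia.
by rewrite ltnn eqxx eqSS subSS.
Qed.

(** Induction on the length. Once the first link (b, i) is removed, the numerator of the Dual-OHM
    entry cancels against the denominator of the inductive value; the sum over i then closes by the
    hockey-stick identity and the sum over b telescopes. *)
Lemma chain_sum_DualOHM (m a : nat) : (n <= a < n + p)%N ->
  chain_sum H m (fun x => (a < x)%N) =
  'C(n + p - a, m.+1)%:R / (n + p - a)%:R.
Proof.
set M := (n + p)%N; have eM : M = (n + p)%N by [].
elim: m a => [|m IH] a /andP[na aM].
  by rewrite chain_sum0 bin1 divff // pnatr_eq0 subn_eq0 -ltnNge.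
rewrite chain_sumS.
pose f b : R := - ('C((M - b).+1, m.+2)%:R / (M - b).+1%:R).
transitivity (\sum_(a.+1 <= b < M) (f b.+1 - f b)); last first.
  rewrite telescope_sumr // /f subnn bin_small // mul0r oppr0 add0r opprK.
  by rewrite subnSK.
rewrite -sum_ord_geq; apply: eq_bigr => -[b bM] /= ab.
pose r := (M - b)%N; have r0 : (0 < r)%N by rewrite subn_gt0.
have rR : r%:R != 0 :> R by rewrite pnatr_eq0 -lt0n.
pose F (k : nat) : R := if k == b then 'C(r, m.+1)%:R / r.+1%:R
                else - ('C(M - k, m.+1)%:R / (r * r.+1)%:R).
transitivity (\sum_(i < M | (b <= i)%N) F i).
  apply: eq_bigr => -[i iM] /= bi.
  have iR : (M - i)%:R != 0 :> R by rewrite pnatr_eq0 subn_eq0 -ltnNge.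
  rewrite glue_DualOHM_block /= ?bi ?andbT ?(leq_ltn_trans na ab) //.
  rewrite IH ?iM ?andbT; last by lia.
  rewrite entry_DualOHM; [|lia|lia].
  rewrite (_ : (p - (i - n)) = M - i)%N; last by rewrite /M; lia.
  rewrite (_ : (p - (b - n)) = r)%N; last by rewrite /r /M; lia.
  rewrite (_ : (b - n == i - n)%N = (i == b :> nat)); last by lia.
  rewrite /F; case: eqP => [->|_].
    by rewrite mulrC mulrA divfK.
  by rewrite mulNr mulrC -mulrA [X in _ * X]mulrA mulVf // mul1r.
rewrite sum_ord_geq big_ltn // {1}/F eqxx.
rewrite (eq_big_nat _ _ (F2 := fun k => - (r * r.+1)%:R^-1 * 'C(M - k, m.+1)%:R)).
  rewrite -mulr_sumr sum_bin_hockey // -/r /f subnSK // -/r opprK binS natrD.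
  rewrite natrM -natr1; field.
  by rewrite rR natr1 pnatr_eq0.
move=> k /andP[bk _]; rewrite /F gtn_eqF //.
by rewrite mulrC mulNr.
Qed.

(** The first link either stays on the diagonal, which gives the binomial term, or ends k rows below
    it with weight c_k; the tail then lies inside the Dual-OHM block. The defining equations are
    thus affine in [c]. *)
Lemma Q_glue_DualOHM (m : nat) : (1 <= p)%N ->
  Q H m.+1 n.+1 = n.+1%:R / (n.+1 + p)%:R * 'C(p, m.+1)%:R
    + \sum_(1 <= k < p) entry c k 1 * ('C(p - k, m.+1)%:R / (p - k)%:R).
Proof.
move=> p1; rewrite Q_chain_sum chain_sumS.
have nM : (n < n + p)%N by rewrite -[X in (X < _)%N]addn0 ltn_add2l.
rewrite (big_pred1 (Ordinal nM)) /=; last by move=> b; rewrite eqSS.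
pose F (k : nat) : R := (if k == n :> nat then (n.+1 * p)%:R / (n.+1 + p)%:R
          else entry c (k - n) 1) * ('C(n + p - k, m.+1)%:R / (n + p - k)%:R).
transitivity (\sum_(i < n + p | (n <= i)%N) F i).
  apply: eq_bigr => i ni; rewrite glue_DualOHM_col // chain_sum_DualOHM //.
  by rewrite ni; apply: ltn_ord.
rewrite sum_ord_geq [LHS]big_ltn // {1}/F eqxx addKn; congr (_ + _).
  by rewrite natrM; field; rewrite -[1]/1%:R -!natrD !pnatr_eq0 -!lt0n p1 andbT.
rewrite -add1n big_addn addKn; apply: eq_big_nat => k /andP[k1 _].
by rewrite /F -[X in _ == X]add0n eqn_add2r gtn_eqF // addnK (addnC k) subnDl.
Qed.

End DualOHMColumn.

Definition glue_DualOHM_column (R : realType) (n p : nat) : 'cV[R]_(p.-1) :=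
  \col_i - (n.+1%:R / (n.+1 + p)%:R * (p - i.+1)%:R / p%:R).

(** The factor p - k of the column cancels the denominator of the chain sums, which leaves a
    hockey-stick sum. *)
Lemma glue_DualOHM_column_eqs (R : realType) (n p : nat) (H1 : 'M[R]_(n.+1.-1)) :
  (1 <= p)%N ->
  @glue_eqs R n.+1 p H1 (H_DualOHM R p) (glue_DualOHM_column R n p).
Proof.
case: p => // q _ [|m] // /andP[_ mq]; rewrite Q_glue_DualOHM //=.
set K : R := n.+1%:R / (n.+1 + q.+1)%:R.
rewrite (eq_big_nat _ _ (F2 := fun k => - (K / q.+1%:R) * 'C(q.+1 - k, m.+1)%:R)).
  rewrite -mulr_sumr sum_bin_hockey // subn0.
  have m1 : m.+1%:R != 0 :> R by rewrite pnatr_eq0.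
  have m2 : m.+2%:R != 0 :> R by rewrite pnatr_eq0.
  (* All binomials are reduced to multiples of binomial(q, m), so that a rational identity
     remains. *)
  have /(canRL (mulKf m1)) E1 :
      m.+1%:R * 'C(q.+1, m.+1)%:R = q.+1%:R * 'C(q, m)%:R :> R.
    by rewrite -!natrM -mul_bin_diag.
  have /(canRL (mulKf m2)) E2 :
      m.+2%:R * 'C(q.+1, m.+2)%:R = q.+1%:R * 'C(q, m.+1)%:R :> R.
    by rewrite -!natrM -mul_bin_diag.
  have /(canRL (mulKf m1)) E3 :
      m.+1%:R * 'C(q, m.+1)%:R = (q%:R - m%:R) * 'C(q, m)%:R :> R.
    by rewrite -natrB // -!natrM mul_bin_left.
  rewrite E1 E2 E3 /K !natrM; field.
  by rewrite -[1]/1%:R -[2]/2%:R -!natrD !pnatr_eq0.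
move=> [|k] // /andP[_ kp].
have kp' : (k < q)%N by [].
rewrite (entry_lt _ kp' (ltn0Sn 0)) mxE /=.
have r0 : (q.+1 - k.+1)%:R != 0 :> R by rewrite pnatr_eq0 subn_eq0 -ltnNge.
move: (_ - _)%:R r0 => r r0; rewrite -/K; field.
by rewrite -[1]/1%:R -natrD pnatr_eq0 r0.
Qed.

Lemma glue_DualOHM (R : realType) (n p : nat) (H1 : 'M[R]_(n.+1.-1)) :
  (1 <= p)%N ->
  @Defs.glue R n.+1 p H1 (H_DualOHM R p) =
  glue_with H1 (H_DualOHM R p) (glue_DualOHM_column R n p).
Proof.
move=> p1; rewrite /Defs.glue; congr glue_with.
have h0 := glue_DualOHM_column_eqs R n p H1 p1; set c0 := glue_DualOHM_column R n p in h0 *.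
(* Since [c0] is a solution, [xget] returns a solution rather than the default 0; uniqueness
   remains. *)
case: xgetP => [c _ hc|/(_ c0)//].
have eqc m : (m < p)%N -> \sum_(1 <= k < p)
    (entry c k 1 - entry c0 k 1) / (p - k)%:R * 'C(p - k, m.+1)%:R = 0.
  move=> mp; have := hc m.+1; rewrite -(h0 m.+1) // => /(_ mp).
  rewrite !Q_glue_DualOHM // => /addrI/eqP; rewrite -subr_eq0 -sumrB => /eqP e.
  by rewrite -[RHS]e; apply: eq_bigr => k _; rewrite -mulrBl mulrAC mulrA.
have {}eqc t : (1 <= t < p)%N -> entry c t 1 = entry c0 t 1.
  elim/ltn_ind: t => t IH /andP[t1 tp].
  (* The equation of index p - t involves c_1, ..., c_t only. *)
  have lt : ((p - t).-1 < p)%N by rewrite prednK ?subn_gt0 ?leq_subr.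
  have := eqc _ lt; rewrite prednK ?subn_gt0 //.
  rewrite (big_cat_nat t1 (ltnW tp)) /=.
  rewrite big_nat big1 ?add0r => [|k /andP[k1 kt]]; last first.
    by rewrite (IH k kt) ?k1 ?(ltn_trans kt) // subrr !mul0r.
  rewrite big_ltn // big_nat big1 ?addr0 => [|k /andP[tk kp]]; last first.
    by rewrite bin_small ?mulr0 //; lia.
  rewrite binn mulr1 => /eqP; rewrite mulf_eq0 invr_eq0 pnatr_eq0 subn_eq0.
  by rewrite leqNgt tp orbF subr_eq0 => /eqP.
apply/matrixP => i j; rewrite (ord1 j).
have ip : (1 <= i.+1 < p)%N by have := ltn_ord i; lia.
by have := eqc _ ip; rewrite -[1%N]/((ord0 : 'I_1).+1) !entryE.
Qed.

(** * Entries of the RDO matrix and the iterations of one period *)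

Lemma entry_castmx {R : realType} {m n m' n' : nat} (e : (m = m') * (n = n'))
    (A : 'M[R]_(m, n)) (k j : nat) : entry (castmx e A) k j = entry A k j.
Proof. by case: e => em en; subst. Qed.

Lemma sum_triangle {V : nmodType} (m : nat) (F : nat -> nat -> V) :
  \sum_(0 <= i < m) \sum_(0 <= j < i.+1) F i j =
  \sum_(0 <= j < m) \sum_(j <= i < m) F i j.
Proof.
elim: m => [|m IH]; first by rewrite !big_nil.
rewrite big_nat_recr // IH [RHS]big_nat_recr //= big_nat1.
rewrite (big_nat_recr m 0 (F m)) //= addrA; congr (_ + _).
rewrite -big_split /=; apply: eq_big_nat => j /andP[_ jm].
by rewrite [RHS]big_nat_recr // ltnW.
Qed.

Section RDO.

Local Arguments H_RDO : simpl never.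

Context {R : realType} (p n : nat).
Hypothesis p_gt0 : (1 <= p)%N.

Let M := (n * p)%N.
Let N : R := (M.+1 + p)%:R.
Let H := H_RDO R p n.+1.

Lemma entry_H_RDO (k j : nat) : (j <= k)%N -> (k < M + p)%N ->
  entry H k.+1 j.+1 =
  if (k < M)%N then entry (H_RDO R p n) k.+1 j.+1
  else if (M < j)%N then entry (H_DualOHM R p) (k - M) (j - M)
  else if k == M then
    if j == M then (M.+1 * p)%:R / N
    else - (p%:R / N) * \sum_(j.+1 <= i < M.+1) entry (H_RDO R p n) i j.+1
  else if j == M then entry (glue_DualOHM_column R M p) (k - M) 1
  else 0.
Proof.
move=> jk kM; have jM := leq_ltn_trans jk kM.
rewrite entry_castmx glue_DualOHM //.
rewrite (@entry_lt _ (M + p) (M + p) _ _ _ kM jM) mxE /=.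
by rewrite (ltnNge k.+1) ltnS jk /= !ltnS !subSS !eqSS.
Qed.

Lemma entry_H_RDO_block (k j : nat) : (1 <= j <= k)%N -> (k < p)%N ->
  entry H (M + k).+1 (M + j).+1 = entry (H_DualOHM R p) k j.
Proof.
case/andP=> j1 jk kp; rewrite entry_H_RDO ?leq_add2l ?ltn_add2l //.
by rewrite ltnNge leq_addr -[X in (X < _)%N]addn0 ltn_add2l j1 !addKn.
Qed.

Context {X : completeNormedModType R} (T : X -> X) (y : nat -> X).
Hypothesis run : is_RDO_run p T y.

Let r j := y j - T (y j).

Lemma RDO_run_prefix (a : nat) : is_run (H_RDO R p a) T y.
Proof. by case: a => [k|a]; [rewrite ltn0 | exact: run]. Qed.

(** The glued row consists of multiples of the column sums of the previous matrix. Exchanging the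
    order of summation turns them into the sum of all earlier steps, which is y_0 - y_M. *)
Lemma RDO_restart :
  y M.+1 - y M = (p%:R / N) *: (y 0%N - y M) - ((M.+1 * p)%:R / N) *: r M.
Proof.
have Mlt : (M < M + p)%N by rewrite -[X in (X < _)%N]addn0 ltn_add2l.
have Mlt' : (M < n.+1 * p)%N by rewrite mulSnr.
rewrite (RDO_run_prefix n.+1 _ Mlt') addrAC subrr add0r big_nat_recr //= opprD.
rewrite entry_H_RDO // ltnn eqxx; congr (_ - _).
have -> : y 0%N - y M = \sum_(0 <= i < M) \sum_(0 <= j < i.+1)
    entry (H_RDO R p n) i.+1 j.+1 *: r j.
  rewrite -opprB -(telescope_sumr y) // -sumrN; apply: eq_big_nat => i /andP[_ iM].
  by rewrite (RDO_run_prefix n _ iM) addrAC subrr add0r opprK.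
rewrite sum_triangle scaler_sumr -sumrN.
apply: eq_big_nat => j /andP[_ jM].
rewrite entry_H_RDO ?(ltnW jM) // ltnn eqxx ltn_eqF // ltnNge (ltnW jM) /=.
rewrite mulNr scaleNr opprK -[LHS]scalerA; congr (_ *: _).
by rewrite scaler_suml big_add1.
Qed.

(** The row used here is zero before the glued column, has c_k in it, and continues with row k of
    Dual-OHM, whose off-diagonal entries share the factor p - k. *)
Lemma RDO_block_step (k : nat) : (1 <= k < p)%N ->
  y (M + k).+1 = y (M + k)%N
    + ((M.+1%:R / N) * ((p - k)%:R / p%:R)) *: r M
    + (p - k)%:R *: \sum_(1 <= j < k) ((p - j) * (p - j).+1)%:R^-1 *: r (M + j)%N
    - ((p - k)%:R / (p - k).+1%:R) *: r (M + k)%N.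
Proof.
case/andP=> k1 kp.
have kM : (M + k < M + p)%N by rewrite ltn_add2l.
have kM' : (M + k < n.+1 * p)%N by rewrite mulSnr.
rewrite (RDO_run_prefix n.+1 _ kM') -!addrA; congr (_ + _).
rewrite (big_cat_nat (leq0n M) (leqW (leq_addr k M))) big_nat big1 ?add0r; last first.
  move=> j /andP[_ jM]; rewrite entry_H_RDO ?(leq_trans (ltnW jM)) ?leq_addr //.
  rewrite ltnNge leq_addr /= ltnNge (ltnW jM) /= (ltn_eqF jM) gtn_eqF ?scale0r //.
  by rewrite -[X in (X < _)%N]addn0 ltn_add2l.
rewrite big_ltn ?ltnS ?leq_addr // entry_H_RDO ?leq_addr //.
rewrite ltnNge leq_addr /= ltnn eqxx gtn_eqF; last first.
  by rewrite -[X in (X < _)%N]addn0 ltn_add2l.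
rewrite addKn -(prednK k1).
have kp' : (k.-1 < p.-1)%N by lia.
rewrite (entry_lt _ kp' (ltn0Sn 0)) mxE /= prednK // -/N.
rewrite add0r scaleNr opprD opprK -mulrA; congr (_ + _).
rewrite -(add1n M) big_addn -addnS addKn.
rewrite big_nat_recr //= opprD -sumrN scaler_sumr; congr (_ + _).
  apply: eq_big_nat => j /andP[j1 jk].
  rewrite addnS (addnC j) entry_H_RDO_block ?j1 ?(ltnW jk) //.
  rewrite entry_DualOHM ?j1 ?(ltnW jk) // (ltn_eqF jk).
  by rewrite scaleNr opprK scalerA.
rewrite addnS (addnC k) entry_H_RDO_block ?k1 /= //.
by rewrite entry_DualOHM ?k1 ?leqnn ?eqxx.
Qed.

End RDO.

(** * Cocoercivity of the residual, induction over the periods, and the rate *)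

Section Residual.

Context {R : realType} {X : completeNormedModType R} (dot : {dot X for idfun}).
Hypothesis dot_norm : norm_from_dot dot.

Definition half_residual (T : X -> X) (u : X) : X := 2^-1 *: (u - T u).

Lemma half_residualK (T : X -> X) (u : X) : u - T u = 2 *: half_residual T u.
Proof. by rewrite scalerA divff ?pnatr_eq0 // scale1r. Qed.

(** With e = u - v one has T u - T v = e - 2 d, and expanding |e - 2 d|^2 <= |e|^2 gives the
    claim. *)
Lemma half_residual_cocoercive (T : X -> X) (u v : X) : nonexpansive T ->
  let d := half_residual T u - half_residual T v in
  dot d d <= dot d (u - v).
Proof.
move=> hT /=; set d := _ - _.
have eT : T u - T v = (u - v) - 2 *: d.
  rewrite scalerBr -!half_residualK !opprD !opprK addrACA.
  by rewrite (addrA u) subrr add0r (addrA (- v)) addNr add0r.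
have : `|T u - T v| ^+ 2 <= `|u - v| ^+ 2 by rewrite ler_sqr ?nnegrE ?normr_ge0.
rewrite -!dot_norm eT; clearbody d; move: (u - v) {eT} => e.
by rewrite !(dotE dot) (dotC dot d e); lra.
Qed.

Lemma half_residual_fixed (T : X -> X) (u : X) : T u = u -> half_residual T u = 0.
Proof. by rewrite /half_residual => ->; rewrite subrr scaler0. Qed.

Lemma RDO_residual_bound (p : nat) (T : X -> X) (y : nat -> X) (k : nat) :
  (1 <= p)%N -> nonexpansive T -> is_RDO_run p T y ->
  let g := half_residual T (y (k * p)%N) in
  (k * p)%:R * dot g g <= dot g (y 0%N - y (k * p)%N).
Proof.
move=> p1 hT run /=; elim: k => [|n IH].
  by rewrite mul0n mul0r subrr linear0r.
rewrite mulSnr; pose g j := half_residual T (y (n * p + j)%N).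
pose K : R := (n * p).+1%:R / ((n * p).+1 + p)%:R.
(* In step k of the block the residuals before the current one contribute 2 (p - k) [avg k]; the
   sequence x of [glued_bound] is (p - k + 1) [avg k]. *)
pose avg k := (K / p%:R) *: g 0%N
  + \sum_(1 <= j < k) ((p - j) * (p - j).+1)%:R^-1 *: g j.
have p0 : p%:R != 0 :> R by rewrite pnatr_eq0 -lt0n.
have avgS k : (1 <= k < p)%N -> (p - k)%:R *: avg k.+1 =
    (p - k)%:R *: avg k + (p - k).+1%:R^-1 *: g k.
  case/andP=> k1 kp; rewrite /avg big_nat_recr //= addrA [LHS]scalerDr; congr (_ + _).
  rewrite scalerA natrM invfM mulrA divff ?mul1r //.
  by rewrite pnatr_eq0 subn_eq0 -ltnNge.
apply: (@glued_bound R X dot (n * p) p (y 0%N) (fun j => y (n * p + j)%N) g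
  (fun j => (p - j).+1%:R *: avg j)) => //=.
- rewrite addn1 !addn0 (RDO_restart p n p1 T y run) half_residualK /g addn0.
  by congr (_ - _); rewrite scalerA [X in X *: _]mulrC mulrA.
- rewrite subnS subn0 prednK // /avg big_geq // addr0 scalerA.
  by rewrite mulrC divfK.
- move=> k hk; have /andP[k1 kp] := hk.
  rewrite subnSK // avgS // [LHS]scalerDr; congr (_ + _).
    by rewrite scalerA [RHS]scalerA mulrC.
  by rewrite scalerA divff ?pnatr_eq0 // scale1r.
- move=> k hk; have /andP[k1 kp] := hk.
  rewrite subnSK // avgS // addnS (RDO_block_step p n p1 T y run k hk) -/K.
  (* This difference is x_(k+1) - x_k; in it the coefficient of [avg k] collapses to -1. *)
  have -> : (p - k)%:R *: avg k + (p - k).+1%:R^-1 *: g k - (p - k).+1%:R *: avg k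
      = (p - k).+1%:R^-1 *: g k - avg k.
    rewrite addrAC -scalerBl -(@natr1 R (p - k)) opprD addrA subrr sub0r.
    by rewrite scaleN1r addrC.
  rewrite [in RHS]scalerBr [in RHS]opprB -!addrA; congr (_ + _); rewrite addrA; congr (_ - _).
    rewrite /avg [RHS]scalerDr; congr (_ + _).
      rewrite half_residualK /g addn0 [LHS]scalerA [RHS]scalerA; congr (_ *: _).
      by field.
    rewrite mulrC -scalerA; congr (_ *: _); rewrite scaler_sumr.
    apply: eq_bigr => j _.
    by rewrite half_residualK [LHS]scalerA [RHS]scalerA mulrC.
  rewrite half_residualK [LHS]scalerA [RHS]scalerA; congr (_ *: _).
  by rewrite [LHS]mulrC mulrA.
- by move=> k kp; apply: half_residual_cocoercive.
- by rewrite /g addn0.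
Qed.

End Residual.

Theorem proposition4 (R : realType) (X : completeNormedModType R)
    (dot : {dot X for idfun}) (hX : norm_from_dot dot)
    (p : nat) (hp : (1 <= p)%N)
    (T : X -> X) (hT : nonexpansive T) (ystar : X) (hystar : T ystar = ystar)
    (y : nat -> X) (hy : is_RDO_run p T y) (k : nat) (hk : (1 <= k)%N) :
  `|y (k * p)%N - T (y (k * p)%N)| ^+ 2
    <= 4 * `|y 0%N - ystar| ^+ 2 / (k * p + 1)%:R ^+ 2.
Proof.
have B := RDO_residual_bound dot hX p T y k hp hT hy.
have := half_residual_cocoercive dot hX T (y (k * p)%N) ystar hT.
rewrite /= (half_residual_fixed T _ hystar) subr0 -!hX half_residualK in B *.
set g := half_residual _ _ in B *; set N : R := (k * p + 1)%:R => C.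
have N0 : 0 < N by rewrite ltr0n addn1.
set e := y 0%N - ystar.
have D : N * dot g g <= dot g e.
  rewrite /e -(subrKA (y (k * p)%N)) dotDr /N natrD mulrDl mul1r.
  exact: lerD.
clear B C; clearbody e g; have := dot_ge0 dot (e - N *: g).
rewrite ler_pdivlMr ?exprn_gt0 // !(dotE dot) (dotC dot e g) => E.
(* This gives N^2 |g|^2 <= N <g, e>, which combined with 0 <= |e - N g|^2 yields N^2 |g|^2 <= |e|^2;
   the factor 4 arises because the residual is 2 g. *)
have := ler_wpM2l (ltW N0) D.
nra.
Qed.
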